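(* Let $\mathfrak g$ be a restricted Lie algebra over $\mathbb F$ and $M$ a restricted $\mathfrak g$-module. With $\delta^1:C^1(\mathfrak g;M)\to C^2(\mathfrak g;M)$ and $\delta^2:C^2(\mathfrak g;M)\to C^3(\mathfrak g;M)$ as defined in the context, $\delta^2\delta^1=0$, so that the quotient $H^2(\mathfrak g;M)=\ker\delta^2/\operatorname{im}\delta^1$ is well defined.
   Context: $\mathbb F$ is a field of characteristic $p>0$. Left-normed brackets: $[g_1,g_2,\dots,g_k]=[[\cdots[[g_1,g_2],g_3]\cdots],g_k]$ (with $[g_1]=g_1$). A restricted Lie algebra is a Lie algebra $\mathfrak g$ over $\mathbb F$ with a map $g\mapsto g^{[p]}$ such that $(\lambda g)^{[p]}=\lambda^pg^{[p]}$; $(g+h)^{[p]}=g^{[p]}+h^{[p]}+\sum\frac1{\#(g)}[g_1,\dots,g_p]$, the sum over words $(g_1,\dots,g_p)$ in the letters $g,h$ with $g_1=g$, $g_2=h$, where $\#(g)$ is the number of letters $g$ in the word; and $[g,h^{[p]}]=[g,h,\dots,h]$ ($p$ copies of $h$). A restricted $\mathfrak g$-module is a $\mathfrak g$-module $M$ with $g^{[p]}x=g^px$ for all $g,x$. Ordinary cochains: $C^q_{\rm cl.}(\mathfrak g;M)=\operatorname{Hom}_{\mathbb F}(\Lambda^q\mathfrak g,M)$, with $\delta_{\rm cl.}\psi(g,h)=-g\psi(h)+h\psi(g)+\psi([g,h])$ for $\psi\in C^1_{\rm cl.}$ and $\delta_{\rm cl.}\varphi(g,h,f)=\varphi([g,h],f)-\varphi([g,f],h)+\varphi([h,f],g)-g\varphi(h,f)+h\varphi(g,f)-f\varphi(g,h)$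 for $\varphi\in C^2_{\rm cl.}$. Restricted cochains: $C^1(\mathfrak g;M)=\operatorname{Hom}_{\mathbb F}(\mathfrak g,M)$. For $\varphi\in C^2_{\rm cl.}(\mathfrak g;M)$, a map $\omega:\mathfrak g\to M$ has the $*$-property with respect to $\varphi$ if for all $\lambda\in\mathbb F$, $g,h\in\mathfrak g$: (i) $\omega(\lambda g)=\lambda^p\omega(g)$; (ii) $$\omega(g+h)=\omega(g)+\omega(h)+\sum_{\substack{g_j=g\text{ or }h\\ g_1=g,\,g_2=h}}\frac1{\#(g)}\sum_{k=0}^{p-2}(-1)^kg_p\cdots g_{p-k+1}\varphi([g_1,\dots,g_{p-k-1}],g_{p-k}).$$ $C^2(\mathfrak g;M)$ is the space of pairs $(\varphi,\omega)$ with $\varphi\in C^2_{\rm cl.}(\mathfrak g;M)$ and $\omega$ having the $*$-property with respect to $\varphi$. For $\psi\in C^1(\mathfrak g;M)$, $\delta^1\psi=(\delta_{\rm cl.}\psi,\tilde\psi)$ where $\tilde\psi(g)=\psi(g^{[p]})-g^{p-1}\psi(g)$ (which has the $*$-property with respect to $\delta_{\rm cl.}\psi$). For $\alpha\in C^3_{\rm cl.}(\mathfrak g;M)$, a map $\beta:\mathfrak g\times\mathfrak g\to M$ has the $**$-property with respect to $\alpha$ if (i) $\beta(g,h)$ is linear in $g$; (ii) $\beta(g,\lambda h)=\lambda^p\beta(g,h)$; (iii) $$\beta(g,h_1+h_2)=\beta(g,h_1)+\beta(g,h_2)-\sum_{\substack{l_1,\dots,l_p\in\{1,2\}\\ l_1=1,\,l_2=2}}\frac1{\#\{i:l_i=1\}}\sum_{j=0}^{p-2}(-1)^j\sum_{k=0}^{j}\binom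 jk h_{l_p}\cdots h_{l_{p-k+1}}\,\alpha\big([g,h_{l_{p-k}},\dots,h_{l_{p-j+1}}],[h_{l_1},\dots,h_{l_{p-j-1}}],h_{l_{p-j}}\big).$$ $C^3(\mathfrak g;M)$ is the space of pairs $(\alpha,\beta)$ with $\alpha\in C^3_{\rm cl.}(\mathfrak g;M)$ and $\beta$ having the $**$-property with respect to $\alpha$. For $(\varphi,\omega)\in C^2(\mathfrak g;M)$, $\delta^2(\varphi,\omega)=(\delta_{\rm cl.}\varphi,\beta)$ where $$\beta(g,h)=\varphi(g,h^{[p]})-\sum_{i+j=p-1}(-1)^ih^i\varphi([g,\underbrace{h,\dots,h}_j],h)+g\,\omega(h)$$ (which has the $**$-property with respect to $\delta_{\rm cl.}\varphi$). *)

(* Defs.v *)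
From HB Require Import structures.
From mathcomp Require Import all_boot all_order all_algebra.
From mathcomp Require Import all_classical.

Set Implicit Arguments.
Unset Strict Implicit.
Unset Printing Implicit Defensive.

Import GRing.Theory.
Local Open Scope classical_set_scope.
Local Open Scope ring_scope.

HB.mixin Record Lmodule_isLie (F : fieldType) L of GRing.Lmodule F L := {
  lie : L -> L -> L;
  lie_linearl : forall y, linear (lie^~ y);
  lie_linearr : forall x, linear (lie x);
  liexx : forall x, lie x x = 0;
  lie_jacobi : forall x y z,
    lie (lie x y) z + lie (lie y z) x + lie (lie z x) y = 0
}.

#[short(type="lieType")]
HB.structure Definition Lie (F : fieldType) :=
  {L of GRing.Lmodule F L & Lmodule_isLie F L}.

(* Left-normed bracket [s_1, ..., s_k]; the value at the empty sequence is
   irrelevant. *)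
Definition lbr (F : fieldType) (L : lieType F) (s : seq L) : L :=
  if s is x :: s' then foldl lie x s' else 0.

(* Words in two letters x, y are boolean words, with true standing for x and
   false for y; letters are thus counted formally, even when x = y. *)
Definition subst_word (T : Type) (x y : T) (w : seq bool) : seq T :=
  [seq if b then x else y | b <- w].

(* The words whose first letter is x and whose second letter is y. *)
Definition admissible (w : seq bool) : bool :=
  nth false w 0 && ~~ nth true w 1.

Definition occ (w : seq bool) : nat := count id w.

HB.mixin Record Lie_isRestricted (p : nat) (F : fieldType) L of Lie F L := {
  pmap : L -> L;
  pmapZ : forall (a : F) x, pmap (a *: x) = a ^+ p *: pmap x;
  pmapD : forall x y, pmap (x + y) = pmap x + pmap y +
    \sum_(w : p.-tuple bool | admissible w)
      (occ w)%:R^-1 *: lbr (subst_word x y w);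
  lie_pmap : forall x y, lie x (pmap y) = lbr (x :: nseq p y)
}.

#[short(type="restrictedLieType")]
HB.structure Definition RestrictedLie (p : nat) (F : fieldType) :=
  {L of Lie F L & Lie_isRestricted p F L}.

HB.mixin Record Lmodule_isLieModule (F : fieldType) (L : lieType F) M
    of GRing.Lmodule F M := {
  act : L -> M -> M;
  act_linearl : forall m, linear (act^~ m);
  act_linearr : forall x, linear (act x);
  act_lie : forall x y m, act (lie x y) m = act x (act y m) - act y (act x m)
}.

#[short(type="lieModType")]
HB.structure Definition LieModule (F : fieldType) (L : lieType F) :=
  {M of GRing.Lmodule F M & Lmodule_isLieModule F L M}.

HB.mixin Record LieModule_isRestricted (p : nat) (F : fieldType)
    (L : restrictedLieType p F) M of LieModule F L M := {
  act_pmap : forall (x : L) (m : M), act (pmap x) m = iter p (act x) m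
}.

#[short(type="restrictedLieModType")]
HB.structure Definition RestrictedLieModule (p : nat) (F : fieldType)
    (L : restrictedLieType p F) :=
  {M of LieModule F L M & LieModule_isRestricted p F L M}.

(* For s = [:: s_1; ...; s_k], s_k ... s_1 m: the last letter acts last. *)
Definition actw (F : fieldType) (L : lieType F) (M : lieModType L)
    (s : seq L) (m : M) : M :=
  foldl (fun m' x => act x m') m s.

Section Classical.
Variables (F : fieldType) (L : lieType F) (M : lieModType L).

Definition Ccl1 : set (L -> M) := [set psi | linear psi].

Definition Ccl2 : set (L -> L -> M) := [set phi |
  [/\ forall y, linear (phi^~ y), forall x, linear (phi x)
    & forall x, phi x x = 0]].

Definition Ccl3 : set (L -> L -> L -> M) := [set alpha |
  [/\ forall y z, linear (fun x => alpha x y z),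
      forall x z, linear (fun y => alpha x y z),
      forall x y, linear (alpha x y)
    & forall x y, [/\ alpha x x y = 0, alpha x y x = 0 & alpha y x x = 0]]].

Definition dcl1 (psi : L -> M) : L -> L -> M := fun g h =>
  - act g (psi h) + act h (psi g) + psi (lie g h).

Definition dcl2 (phi : L -> L -> M) : L -> L -> L -> M := fun g h f =>
  phi (lie g h) f - phi (lie g f) h + phi (lie h f) g
  - act g (phi h f) + act h (phi g f) - act f (phi g h).

End Classical.

Arguments Ccl1 {F L} M.
Arguments Ccl2 {F L} M.
Arguments Ccl3 {F L} M.

Section Restricted.
Variables (p : nat) (F : fieldType) (L : restrictedLieType p F).
Variable M : restrictedLieModType L.

(* The letters of a word s of length p are indexed from 0 by nth, so that s_i is
   nth 0 s i.-1, while s_p ... s_(p-k+1) m is actw (drop (p - k) s) m. *)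
Definition star_term (phi : L -> L -> M) (s : seq L) : M :=
  \sum_(k < p.-1) (-1) ^+ k *:
    actw (drop (p - k) s)
      (phi (lbr (take (p - k - 1) s)) (nth 0 s (p - k - 1))).

Definition star_property (phi : L -> L -> M) (omega : L -> M) : Prop :=
  (forall (a : F) g, omega (a *: g) = a ^+ p *: omega g) /\
  (forall g h, omega (g + h) = omega g + omega h +
     \sum_(w : p.-tuple bool | admissible w)
       (occ w)%:R^-1 *: star_term phi (subst_word g h w)).

(* Here rev (drop (p - j) (take (p - k) s)) is s_(p-k), ..., s_(p-j+1). *)
Definition dstar_term (alpha : L -> L -> L -> M) (g : L) (s : seq L) : M :=
  \sum_(j < p.-1) (-1) ^+ j *:
    \sum_(k < j.+1) 'C(j, k)%:R *:
      actw (drop (p - k) s)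
        (alpha (lbr (g :: rev (drop (p - j) (take (p - k) s))))
               (lbr (take (p - j - 1) s))
               (nth 0 s (p - j - 1))).

Definition dstar_property (alpha : L -> L -> L -> M) (beta : L -> L -> M)
    : Prop :=
  [/\ forall h, linear (beta^~ h),
      forall (a : F) g h, beta g (a *: h) = a ^+ p *: beta g h
    & forall g h1 h2, beta g (h1 + h2) = beta g h1 + beta g h2 -
        \sum_(w : p.-tuple bool | admissible w)
          (occ w)%:R^-1 *: dstar_term alpha g (subst_word h1 h2 w)].

Definition C1 : set (L -> M) := Ccl1 M.

Definition C2 : set ((L -> L -> M) * (L -> M)) :=
  [set c | Ccl2 M c.1 /\ star_property c.1 c.2].

Definition C3 : set ((L -> L -> L -> M) * (L -> L -> M)) :=
  [set c | Ccl3 M c.1 /\ dstar_property c.1 c.2].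

Definition delta1 (psi : L -> M) : (L -> L -> M) * (L -> M) :=
  (dcl1 psi, fun g => psi (pmap g) - iter p.-1 (act g) (psi g)).

Definition delta2 (c : (L -> L -> M) * (L -> M))
    : (L -> L -> L -> M) * (L -> L -> M) :=
  (dcl2 c.1, fun g h =>
     c.1 g (pmap h)
     - \sum_(i < p) (-1) ^+ i *:
         iter i (act h) (c.1 (lbr (g :: nseq (p.-1 - i) h)) h)
     + act g (c.2 h)).

Definition ker2 : set ((L -> L -> M) * (L -> M)) :=
  [set c | C2 c /\ delta2 c = 0].

Definition im1 : set ((L -> L -> M) * (L -> M)) := delta1 @` C1.

End Restricted.

Arguments C1 {p F L} M.
Arguments C2 {p F L} M.
Arguments C3 {p F L} M.
Arguments ker2 {p F L} M.
Arguments im1 {p F L} M.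

Definition subspace (F : fieldType) (V : lmodType F) (A : set V) : Prop :=
  A 0 /\ forall (a : F) x y, A x -> A y -> A (a *: x + y).

Definition linear_on (F : fieldType) (V W : lmodType F) (A : set V)
    (f : V -> W) : Prop :=
  forall (a : F) x y, A x -> A y -> f (a *: x + y) = a *: f x + f y.

(* The pair (Q, pi) is a quotient of Z by B, where Z and B are subspaces of V:
   pi is linear and onto on Z, and B is its kernel there; in particular B is
   contained in Z.  The values of pi outside Z are irrelevant. *)
Definition is_quotient (F : fieldType) (V : lmodType F) (Z B : set V)
    (Q : lmodType F) (pi : V -> Q) : Prop :=
  [/\ linear_on Z pi, forall q, exists2 z, Z z & pi z = q
    & B = [set z | Z z /\ pi z = 0]].

(* Main.v *)
From HB Require Import structures.
Require Import Defs.
From mathcomp Require Import all_boot all_order all_algebra.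
From mathcomp Require Import all_classical.

(* Let E = M + L carry the bracket [(m,x),(n,y)] = (x n - y m + phi(x,y), [x,y])
   and let R_y be right multiplication by (0,y).  The correction terms of the
   *-property are the M-components of left-normed brackets in E.  Jacobson's
   formula for (a + b)^p, applied to operators, gives the *-property of
   delta1 psi (in the semidirect product, represented on M + F).  Applied to
   R_{h1} + R_{h2} on E, it gives beta(g, h1 + h2) - beta(g, h1) - beta(g, h2)
   as a sum over words w of the difference between R_[w] and the left-normed
   commutator of the R_{w_i}.  The Jacobi identity of E fails exactly by
   dcl2 phi, so this difference satisfies
     D(g, w y) = - y D(g, w) - D([g,y], w) + dcl2 phi (g, [w], y).
   After summation over the words with a given number of letters h1, the first
   two operators commute, and the binomial theorem yields the **-property.
   Finally, ad(x)^p = ad(x^p) in the semidirect product gives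
   delta2 (delta1 psi) = 0. *)

Set Implicit Arguments.
Unset Strict Implicit.
Unset Printing Implicit Defensive.

Import GRing.Theory.
Local Open Scope classical_set_scope.
Local Open Scope ring_scope.

(** * Additive maps and sums over words *)

Section AdditiveMaps.
Variables (U V : zmodType) (f : U -> V).
Hypothesis fD : {morph f : x y / x + y}.

Lemma morphD0 : f 0 = 0.
Proof. by apply: (addrI (f 0)); rewrite -fD !addr0. Qed.

Lemma morphDN x : f (- x) = - f x.
Proof. by apply: (addrI (f x)); rewrite -fD !subrr morphD0. Qed.

Lemma morphDMn n x : f (x *+ n) = f x *+ n.
Proof. by elim: n => [|n IH]; rewrite ?mulr0n ?morphD0// !mulrS fD IH. Qed.

Lemma morphD_sum (I : Type) (r : seq I) (P : pred I) (E : I -> U) :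
  f (\sum_(i <- r | P i) E i) = \sum_(i <- r | P i) f (E i).
Proof. exact: (big_morph f fD morphD0). Qed.

End AdditiveMaps.

Lemma iter_morphD (V : zmodType) (f : V -> V) n :
  {morph f : x y / x + y} -> {morph iter n f : x y / x + y}.
Proof. by move=> fD x y; elim: n => //= n ->; rewrite fD. Qed.

Section LinearMaps.
Variables (F : fieldType) (U V : lmodType F) (f : U -> V).
Hypothesis lf : linear f.

Lemma linD : {morph f : x y / x + y}.
Proof. by move=> x y; rewrite -[x]scale1r lf !scale1r. Qed.

Lemma linZ (a : F) x : f (a *: x) = a *: f x.
Proof. by rewrite -[a *: x]addr0 lf (morphD0 linD) addr0. Qed.

Lemma lin0 : f 0 = 0.
Proof. exact: morphD0 linD. Qed.

Lemma linN x : f (- x) = - f x.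
Proof. exact: morphDN linD x. Qed.

Lemma lin_sum (I : Type) (r : seq I) (P : pred I) (E : I -> U) :
  f (\sum_(i <- r | P i) E i) = \sum_(i <- r | P i) f (E i).
Proof. exact: morphD_sum linD _ _ _ _. Qed.

End LinearMaps.

Lemma linear_iter (F : fieldType) (V : lmodType F) (f : V -> V) n :
  linear f -> linear (iter n f).
Proof. by move=> lf a x y; elim: n => //= n ->; rewrite lf. Qed.

(** The binomial theorem for commuting additive operators, by induction on n with Pascal's rule. *)
Lemma iterD_commute (W : zmodType) (P Q : W -> W) n w :
  {morph P : x y / x + y} -> {morph Q : x y / x + y} ->
  (forall x, Q (P x) = P (Q x)) ->
  iter n (fun x => P x + Q x) w =
  \sum_(k < n.+1) iter k P (iter (n - k) Q w) *+ 'C(n, k).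
Proof.
move=> PD QD PQ; elim: n => [|n IH].
  by rewrite big_ord_recl big_ord0 addr0 bin0.
have QPk k x : Q (iter k P x) = iter k P (Q x).
  by elim: k => //= k <-; rewrite PQ.
(* The P-sum gives up its top term and the Q-sum its bottom term; the remaining terms pair off by
   Pascal's rule. *)
rewrite iterS IH (morphD_sum PD) (morphD_sum QD) big_ord_recr /=.
rewrite [X in _ + X]big_ord_recl [RHS]big_ord_recr [in RHS]big_ord_recl /=.
rewrite [X in _ + X]addrC addrACA [X in _ + X]addrC addrA [in RHS]addrC.
rewrite !bin0 !binn !mulr1n !subn0 !subnn /= [RHS]addrC; congr (_ + _).
rewrite addrC; congr (_ + _); rewrite -big_split /=; apply: eq_bigr => i _.
rewrite /bump /= add0n add1n binS mulrnDr (morphDMn PD) (morphDMn QD) subSS.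
by rewrite addrC PQ QPk -[Q (iter _ Q w)]iterS -subSn ?ltn_ord.
Qed.

(** * Sums over boolean words of fixed length *)

Section TupleSums.
Variable V : zmodType.

Lemma sum_tuple_cons n (G : seq bool -> V) :
  \sum_(w : n.+1.-tuple bool) G w =
  \sum_(w : n.-tuple bool) (G (true :: w) + G (false :: w)).
Proof.
transitivity (\sum_(w : bool * n.-tuple bool) G (w.1 :: w.2)).
  rewrite (reindex (fun w : bool * n.-tuple bool => cons_tuple w.1 w.2)) //=.
  exists (fun w : n.+1.-tuple bool => (thead w, [tuple of behead w])) => /=.
    by case=> b w _; congr pair; apply: val_inj.
  by move=> w _; case/tupleP: w => b w; apply: val_inj.
rewrite -(pair_bigA _ (fun b (w : n.-tuple bool) => G (b :: w))) /=.
by rewrite exchange_big; apply: eq_bigr => w _; rewrite big_bool.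
Qed.

(** Follows from [sum_tuple_cons] by reversing words. Recursion on the last letter suits left-normed
    brackets, which grow on the right. *)
Lemma sum_tuple_rcons n (G : seq bool -> V) :
  \sum_(w : n.+1.-tuple bool) G w =
  \sum_(w : n.-tuple bool) (G (rcons w true) + G (rcons w false)).
Proof.
have sum_rev m (H : seq bool -> V) :
    \sum_(w : m.-tuple bool) H w = \sum_(w : m.-tuple bool) H (rev w).
  rewrite (reindex_inj (h := fun w : m.-tuple bool => rev_tuple w)) //.
  by apply: (can_inj (g := fun w => rev_tuple w)) => w; apply: val_inj;
     rewrite /= revK.
rewrite sum_rev (sum_tuple_cons n (G \o rev)) .
rewrite (sum_rev n (fun w => G (rcons w true) + G (rcons w false))) /=.
by apply: eq_bigr => w _; rewrite !rev_cons.
Qed.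

Lemma sum_admissible n (G : seq bool -> V) :
  \sum_(w : n.+2.-tuple bool | admissible w) G w =
  \sum_(w : n.-tuple bool) G [:: true, false & w].
Proof.
rewrite big_mkcond.
rewrite (sum_tuple_cons n.+1 (fun w => if admissible w then G w else 0)) /=.
rewrite [LHS](sum_tuple_cons n (fun w : seq bool =>
  (if admissible (true :: w) then G (true :: w) else 0) +
  (if admissible (false :: w) then G (false :: w) else 0))) /=.
by apply: eq_bigr => w _; rewrite /admissible /= !addr0 add0r.
Qed.

End TupleSums.

(* A sequence [z : nat -> V] stands for the polynomial [\sum_c z c t^c], and
   [gmul a b] for the operator [t a + b]. *)
Section WordPolynomials.
Variable V : zmodType.
Implicit Types (a b : V -> V) (z : nat -> V) (G : seq bool -> V).

Definition gmul a b z : nat -> V :=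
  fun c => (if c is c'.+1 then a (z c') else 0) + b (z c).

(** The generating polynomial of [G], in which t marks the letter [true]. *)
Definition gen n G : nat -> V :=
  fun c => \sum_(w : n.-tuple bool | occ w == c) G w.

Lemma gen_ext n G1 G2 :
  (forall w, size w = n -> G1 w = G2 w) -> gen n G1 = gen n G2.
Proof.
move=> eqG; apply/funext => c; apply: eq_bigr => w _.
by rewrite eqG ?size_tuple.
Qed.

Lemma gen0 G : gen 0 G = fun c => if c is 0 then G [::] else 0.
Proof.
apply/funext => c; rewrite /gen.
case: c => [|c]; last by rewrite big1 // => w; rewrite tuple0.
rewrite (big_pred1 [tuple]) // => w; rewrite tuple0.
by apply/esym/eqP.
Qed.

Lemma genS n G : gen n.+1 G =
  (fun c => (if c is c'.+1 then gen n (fun w => G (rcons w true)) c' else 0)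
    + gen n (fun w => G (rcons w false)) c).
Proof.
apply/funext => c; rewrite /gen big_mkcond.
rewrite (sum_tuple_rcons n (fun w => if occ w == c then G w else 0)) big_split.
congr (_ + _); last first.
  rewrite -big_mkcond; apply: eq_bigl => w.
  by rewrite /occ -cats1 count_cat addn0.
rewrite /occ; case: c => [|c].
  by rewrite big1 // => w _; rewrite -cats1 count_cat addn1.
rewrite -big_mkcond; apply: eq_bigl => w.
by rewrite -cats1 count_cat addn1 eqSS.
Qed.

Lemma genD n G1 G2 :
  gen n (fun w => G1 w + G2 w) = gen n G1 + gen n G2.
Proof. by apply/funext => c; rewrite fctE /gen -big_split. Qed.

(** Words are grouped by their number of letters [true], so a sum weighted by a function of [occ] is
    determined by [gen]. *)
Lemma sum_gen (F : fieldType) (W : lmodType F) n (wt : nat -> F)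
    (G : seq bool -> W) :
  \sum_(c < n.+1) wt c *: \sum_(w : n.-tuple bool | occ w == c) G w =
  \sum_(w : n.-tuple bool) wt (occ w) *: G w.
Proof.
have occlt (w : n.-tuple bool) : (occ w < n.+1)%N.
  by rewrite ltnS -[X in (_ <= X)%N](size_tuple w) count_size.
rewrite [RHS](partition_big (fun w => Ordinal (occlt w)) predT) //=.
apply: eq_bigr => c _; rewrite scaler_sumr.
apply: eq_big => [w|w /eqP <-] //.
Qed.

(** Applying t a + b appends a letter: [true] contributes a and one power of t, [false] contributes
    b. *)
Lemma gmul_gen a b n G : {morph a : x y / x + y} -> {morph b : x y / x + y} ->
  gmul a b (gen n G) =
  gen n.+1 (fun w => (if last true w then a else b) (G (take n w))).
Proof.
move=> aD bD; rewrite genS; apply/funext => c; rewrite /gmul.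
have e l m : gen n (fun w => (if last true (rcons w l) then a else b)
                                (G (take n (rcons w l)))) m
    = (if l then a else b) (gen n G m).
  rewrite /gen; case: l; rewrite (morphD_sum aD, morphD_sum bD);
  by apply: eq_bigr => w _; rewrite last_rcons -cats1 takel_cat ?size_tuple //
     take_oversize ?size_tuple.
by case: c => [|c]; rewrite !e.
Qed.

Lemma iter_gmul_gen a b k n G :
  {morph a : x y / x + y} -> {morph b : x y / x + y} ->
  iter k (gmul a b) (gen n G) =
  gen (n + k) (fun w => foldl (fun v (l : bool) => (if l then a else b) v)
                         (G (take n w)) (drop n w)).
Proof.
move=> aD bD; elim: k => [|k IH] /=.
  rewrite addn0; apply: gen_ext => w sw.
  by rewrite take_oversize ?drop_oversize ?sw.
rewrite IH gmul_gen // addnS; apply: gen_ext => w.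
case/lastP: w => [|w l] // ; rewrite size_rcons => -[sw].
rewrite last_rcons -cats1 !takel_cat ?sw ?leqnn ?leq_addr //.
rewrite (take_oversize (n := n + k)) ?sw // drop_cat sw.
case: ltnP => [|kn]; first by rewrite foldl_cat.
have -> : k = 0%N by apply/eqP; rewrite -leqn0 -(leq_add2l n) addn0.
rewrite addn0 subnn drop0 /= drop_oversize //= sw.
by move: kn; rewrite -{2}[n]addn0 leq_add2l leqn0 => /eqP ->; rewrite addn0.
Qed.

Lemma gmulD a b : {morph a : x y / x + y} -> {morph b : x y / x + y} ->
  {morph gmul a b : x y / x + y}.
Proof.
move=> aD bD x y; apply/funext => -[|c]; rewrite !fctE /gmul ?aD ?bD ?add0r //.
by rewrite addrACA.
Qed.

End WordPolynomials.

(** * Jacobson's formula *)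

Section PrimeCharacteristic.
Variables (F : fieldType) (p : nat).
Hypothesis charFp : p \in [pchar F].

(** By Pascal's rule consecutive values are opposite, since C(p, k+1) vanishes in F for 0 < k + 1 <
    p. *)
Lemma bin_pred_pchar k : (k < p)%N -> 'C(p.-1, k)%:R = (-1) ^+ k :> F.
Proof.
have p_gt0 := prime_gt0 (pcharf_prime charFp).
elim: k => [|k IH] kp; first by rewrite bin0.
have /eqP := bin_lt_pcharf_0 charFp (k := k.+1) kp.
rewrite -(prednK p_gt0) binS natrD (IH (ltnW kp)) addr_eq0 exprS mulN1r.
by move/eqP.
Qed.

(** The case k = p - 1 of [bin_pred_pchar], which includes p = 2 without a separate argument. *)
Lemma sign_pred_pchar : (-1) ^+ p.-1 = 1 :> F.
Proof.
have p_gt0 := prime_gt0 (pcharf_prime charFp).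
by rewrite -bin_pred_pchar ?binn // prednK.
Qed.

Lemma sign_pchar : (-1) ^+ p = -1 :> F.
Proof.
have p_gt0 := prime_gt0 (pcharf_prime charFp).
by rewrite -[X in _ ^+ X](prednK p_gt0) exprS sign_pred_pchar mulr1.
Qed.

Lemma natr_pchar_neq0 n : (0 < n < p)%N -> n%:R != 0 :> F.
Proof.
move=> /andP[n0 np]; rewrite -(dvdn_pcharf charFp) gtnNdvd //.
Qed.

End PrimeCharacteristic.

(* Operators act on the right in the left-normed commutators below:
   [ccomm x k] is the commutator [k, x] for the reversed composition. *)
Definition ccomm (V : zmodType) (x k : V -> V) : V -> V :=
  fun v => x (k v) - k (x v).

Lemma ccommD (V : zmodType) (x : V -> V) :
  {morph x : u v / u + v} -> {morph ccomm x : k l / k + l}.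
Proof.
by move=> xD k l; apply/funext => v; rewrite /ccomm !fctE xD opprD addrACA.
Qed.

(** * Iterated commutators and derivations *)

Section IteratedCommutators.
Variables (F : fieldType) (W : lmodType F) (T X D : W -> W).
Hypothesis TD : {morph T : x y / x + y}.

(** The commutator with T is the sum of two commuting operators, composition with T on one side and
    its negative on the other, so the binomial theorem applies. *)
Lemma iter_ccomm n w : iter n (ccomm T) X w =
  \sum_(k < n.+1)
    ((-1) ^+ (n - k) * 'C(n, k)%:R : F) *: iter k T (X (iter (n - k) T w)).
Proof.
pose P (f : W -> W) : W -> W := fun v => T (f v).
pose Q (f : W -> W) : W -> W := fun v => - f (T v).
have PD : {morph P : x y / x + y}.
  by move=> f g; apply/funext => v; rewrite /P !fctE TD.
have QD : {morph Q : x y / x + y}.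
  by move=> f g; apply/funext => v; rewrite /Q !fctE opprD.
have PQ f : Q (P f) = P (Q f).
  by apply/funext => v; rewrite /P /Q (morphDN TD).
have -> : ccomm T = fun f => P f + Q f by [].
rewrite (iterD_commute _ _ PD QD PQ) fct_sumE; apply: eq_bigr => k _.
have -> m f : iter m Q f = fun v => (-1 : F) ^+ m *: f (iter m T v).
  elim: m => [|m IH]; apply/funext => v; first by rewrite scale1r.
  by rewrite iterS IH /Q exprS -scalerA scaleN1r iterSr.
have PZ m f : iter m P f = fun v => iter m T (f v).
  by elim: m => //= m ->.
rewrite PZ -scaler_nat fctE mulrC -scalerA; congr (_ *: _).
rewrite -signr_odd; case: (odd _); rewrite ?scale1r // !scaleN1r.
by rewrite (morphDN (iter_morphD k TD)).
Qed.

Variable p : nat.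
Hypothesis charFp : p \in [pchar F].

(** This is ad(T)^p = ad(T^p): the inner binomial coefficients vanish in characteristic p. *)
Lemma iter_ccomm_pchar w :
  iter p (ccomm T) X w = iter p T (X w) - X (iter p T w).
Proof.
have := prime_gt0 (pcharf_prime charFp).
case: p charFp => // n charFn _.
rewrite iter_ccomm big_ord_recr big_ord_recl big1 => [|i _].
  rewrite /= addr0 binn bin0 subnn subn0 (sign_pchar charFn) !mulr1 expr0.
  by rewrite scale1r scaleN1r addrC.
by rewrite (bin_lt_pcharf_0 charFn) ?mulr0 ?scale0r //= ltnS /bump ltn_ord.
Qed.

(** Every coefficient becomes 1, because C(p-1, k) equals the sign (-1)^(p-1-k) in F. *)
Lemma iter_ccomm_pred_pchar w : iter p.-1 (ccomm T) X w =
  \sum_(k < p) iter k T (X (iter (p.-1 - k) T w)).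
Proof.
have p_gt0 := prime_gt0 (pcharf_prime charFp).
rewrite iter_ccomm prednK //; apply: eq_bigr => k _.
have kp : (k <= p.-1)%N by rewrite -ltnS prednK.
rewrite -bin_sub // (bin_pred_pchar charFp) ?signrMK.
  by rewrite -expr2 sqrr_sign scale1r.
by rewrite -[X in (_ < X)%N](prednK p_gt0) ltnS leq_subr.
Qed.

(** Leibniz rule for T^n, with X as the derivative of T. For n = p the sum is ad(T)^(p-1) X. *)
Lemma derivation_iter n w : (forall v, D (T v) = T (D v) + X v) ->
  D (iter n T w) =
  iter n T (D w) + \sum_(k < n) iter k T (X (iter (n.-1 - k) T w)).
Proof.
move=> DT; elim: n => [|n IH]; first by rewrite big_ord0 addr0.
rewrite iterS DT IH TD (morphD_sum TD) -addrA; congr (_ + _).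
rewrite [RHS]big_ord_recl /= subn0 addrC; congr (_ + _).
by apply: eq_bigr => i _; rewrite /bump /= -subn1 -subnDA.
Qed.

End IteratedCommutators.

Section Jacobson.
Variables (F : fieldType) (p : nat) (V : lmodType F) (a b : V -> V).
Hypotheses (charFp : p \in [pchar F])
  (aD : {morph a : x y / x + y}) (bD : {morph b : x y / x + y}).

(** On polynomials in t, T is t a + b, X is its derivative a, [shift] is multiplication by t, and
    [const] embeds V as the constants. *)
Let T := gmul a b.
Let X (z : nat -> V) : nat -> V := fun c => a (z c).
Let shift (z : nat -> V) : nat -> V := fun c => if c is c'.+1 then z c' else 0.
Let const v : nat -> V := gen 0 (fun=> v).

Let TD : {morph T : x y / x + y}.
Proof. exact: gmulD. Qed.

Let T_shift z : T (shift z) = shift (T z).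
Proof.
by apply/funext => -[|[|c]];
   rewrite /T /gmul /= ?(morphD0 aD) ?(morphD0 bD) ?addr0.
Qed.

Let T_const v : T (const v) = const (b v) + shift (const (a v)).
Proof.
by apply/funext => c; rewrite /T /const /shift !gen0 /gmul !fctE /=;
   case: c => [|[|c]]; rewrite ?(morphD0 aD) ?(morphD0 bD) ?addr0 ?add0r.
Qed.

(** Iterated commutators with T commute with multiplication by t, so they are polynomials in t with
    operators on V as coefficients; each further commutator acts on these by t [ccomm a] +
    [ccomm b]. *)
Lemma iter_ccomm_const n v : iter n (ccomm T) X (const v) =
  fun c => iter n (gmul (ccomm a) (ccomm b)) (gen 0 (fun=> a)) c v.
Proof.
have KD m : {morph iter m (ccomm T) X : x y / x + y}.
  elim: m => [|m IH] x y; first by apply/funext => c; rewrite /X !fctE /= aD.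
  by rewrite iterS /ccomm IH !TD IH opprD addrACA.
have K_shift m z : iter m (ccomm T) X (shift z) = shift (iter m (ccomm T) X z).
  elim: m z => [|m IH] z.
    by apply/funext => -[|c]; rewrite /X //= (morphD0 aD).
  rewrite iterS /ccomm IH !T_shift IH; apply/funext => -[|c] //.
  by rewrite /shift !fctE subrr.
elim: n v => [|n IH] v.
  by apply/funext => -[|c]; rewrite /X /const !gen0 //= (morphD0 aD).
rewrite iterS {1}/ccomm T_const KD K_shift !IH; apply/funext => c.
rewrite iterS; move: (iter n (gmul _ _) _) => k.
rewrite /T /gmul /ccomm /shift; case: c => [|c]; rewrite !fctE /=.
  by rewrite !add0r addr0.
by rewrite opprD [X in _ + X]addrC addrACA.
Qed.

(** T^n v has degree at most n in t, with leading coefficient a^n v. *)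
Let iter_T_top n v c : (n <= c)%N ->
  iter n T (const v) c = if c == n then iter n a v else 0.
Proof.
elim: n c => [|n IH] c; first by rewrite /const gen0; case: c.
case: c => // c; rewrite ltnS => nc; rewrite /= {1}/T /gmul !IH ?(leqW nc) //.
rewrite eqSS [c.+1 == n]gtn_eqF ?ltnS // (morphD0 bD) addr0.
by case: eqP; rewrite ?(morphD0 aD).
Qed.

(** Evaluation at t = 1, where T becomes a + b. *)
Let sum_iter_T n v :
  \sum_(c < n.+1) iter n T (const v) c = iter n (fun x => a x + b x) v.
Proof.
elim: n => [|n IH]; first by rewrite big_ord1 /const gen0.
rewrite [RHS]iterS -IH (morphD_sum aD) (morphD_sum bD).
rewrite (eq_bigr (fun c : 'I_n.+2 => shift (X (iter n T (const v))) c
  + b (iter n T (const v) c))) //.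
rewrite big_split; congr (_ + _); first by rewrite big_ord_recl /= add0r.
rewrite big_ord_recr /= (iter_T_top _ (leqnSn n)) gtn_eqF //.
by rewrite (morphD0 bD) addr0.
Qed.

(** The t-derivative of (t a + b)^p is ad(T)^(p-1) X, whose coefficients are sums of left-normed
    commutators. Dividing by the exponents recovers the coefficients of degrees 1 to p - 1; then t
    is set to 1. *)
Lemma jacobson v : iter p (fun x => a x + b x) v = iter p a v + iter p b v +
  \sum_(w : p.-tuple bool | admissible w) (occ w)%:R^-1 *:
    foldl (fun k (l : bool) => ccomm (if l then a else b) k) a (behead w) v.
Proof.
have p_gt1 := prime_gt1 (pcharf_prime charFp).
have [n pE] : exists n, p = n.+2 by exists p.-2; case: (p) p_gt1 => [|[|]].
pose G w := foldl (fun k (l : bool) => ccomm (if l then a else b) k) a w.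
have e : foldl (fun k (l : bool) => (if l then ccomm a else ccomm b) k) =
    foldl (fun k (l : bool) => ccomm (if l then a else b) k).
  by congr foldl; apply/funext => k; apply/funext => -[].
(* Formal differentiation in t. *)
pose D (z : nat -> V) : nat -> V := fun c => z c.+1 *+ c.+1.
have DT z : D (T z) = T (D z) + X z.
  apply/funext => -[|d]; rewrite /D /T /X /gmul !fctE /=.
    by rewrite !mulr1n add0r addrC.
  rewrite (morphDMn aD) (morphDMn bD) mulrnDl mulrSr addrAC.
  by rewrite -!addrA.
have coef c : iter p T (const v) c.+1 *+ c.+1 = gen p.-1 G c v.
  have := derivation_iter TD p (const v) DT.
  rewrite -(iter_ccomm_pred_pchar _ TD charFp) iter_ccomm_const.
  rewrite (iter_gmul_gen _ _ _ (ccommD aD) (ccommD bD)).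
  have -> : D (const v) = 0.
    by apply/funext => d; rewrite /D /const gen0 mul0rn.
  rewrite (morphD0 (iter_morphD p TD)) add0r => /(congr1 (@^~ c)).
  rewrite {1}/D => ->; congr (gen _ _ _ _).
  by apply/funext => w; rewrite drop0 e.
have T0 : iter p T (const v) 0%N = iter p b v.
  by elim: (p) => [|m IH]; rewrite ?iterS -?IH /T ?/gmul ?add0r // /const gen0.

(* At i + 1 = p the inverse is that of 0, which is 0, and the leading coefficient a^p v stands
   alone. *)
have coefV (i : 'I_p) : iter p T (const v) i.+1 =
    (if i.+1 == p then iter p a v else 0) + i.+1%:R^-1 *: gen p.-1 G i v.
  have [ip|ip] := eqVneq i.+1 p.
    by rewrite ip iter_T_top // eqxx (pcharf0 charFp) invr0 scale0r addr0.
  rewrite add0r -coef -scaler_nat scalerA mulVf ?scale1r //.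
  by rewrite (natr_pchar_neq0 charFp) //= ltn_neqAle ip ltn_ord.
rewrite -sum_iter_T big_ord_recl T0 addrAC addrC; congr (_ + _).
rewrite (eq_bigr _ (fun i _ => coefV i)) big_split; congr (_ + _).
  have pp : (p.-1 < p)%N by rewrite prednK // ltnW.
  rewrite -big_mkcond (big_pred1 (Ordinal pp)) // => i.
  by rewrite /= -val_eqE /= -[RHS]eqSS prednK // ltnW.
(* Here w lacks the initial letter [true], whence the successor in the weight. *)
transitivity (\sum_(w : n.+1.-tuple bool) (occ w).+1%:R^-1 *: G w v).
  have -> : n.+1 = p.-1 by rewrite pE.
  rewrite -(sum_gen _ (fun c => c.+1%:R^-1) (fun w => G w v)).
  rewrite prednK ?(ltnW p_gt1) //.
  by apply: eq_bigr => i _; rewrite /gen fct_sumE.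
rewrite [in RHS]pE [RHS](sum_admissible n
  (fun w => (occ w)%:R^-1 *: G (behead w) v)).
rewrite (sum_tuple_cons n (fun w => (occ w).+1%:R^-1 *: G w v)).
apply: eq_bigr => w _; rewrite /occ /= add1n add0n.
(* Words whose second letter is also [true] vanish since [a, a] = 0; the admissible ones remain. *)
suff -> : G (true :: w) = 0 by rewrite scaler0 add0r.
rewrite /G /=.
have -> : ccomm a a = 0 by apply/funext => x; rewrite /ccomm subrr.
by elim: (tval w) => //= l u IH; case: l; rewrite (morphD0 (ccommD _)).
Qed.

End Jacobson.

(** * Identities in abelian groups *)

Inductive zexpr := ZVar of nat | ZAdd of zexpr & zexpr | ZOpp of zexpr | ZZero.

Fixpoint zeval (V : zmodType) (env : seq V) (e : zexpr) : V :=
  match e with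
  | ZVar i => nth 0 env i
  | ZAdd e1 e2 => zeval env e1 + zeval env e2
  | ZOpp e1 => - zeval env e1
  | ZZero => 0
  end.

(* Number of occurrences of the variable [i] in [e] with sign [s]. *)
Fixpoint zcount (s : bool) (e : zexpr) (i : nat) : nat :=
  match e with
  | ZVar j => s && (i == j)
  | ZAdd e1 e2 => (zcount s e1 i + zcount s e2 i)%N
  | ZOpp e1 => zcount (~~ s) e1 i
  | ZZero => 0
  end.

Lemma zevalE (V : zmodType) (env : seq V) e : zeval env e =
  \sum_(i < size env) nth 0 env i *+ zcount true e i -
  \sum_(i < size env) nth 0 env i *+ zcount false e i.
Proof.
elim: e => [j|e1 IH1 e2 IH2|e1 IH1|] /=.
- rewrite [X in _ - X]big1 // subr0.
  have [jlt|jge] := ltnP j (size env).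
    rewrite (bigD1 (Ordinal jlt)) //= eqxx big1 ?addr0 // => i.
    by rewrite -val_eqE /= => /negPf ->.
  rewrite nth_default // big1 // => i _.
  by rewrite ltn_eqF // (leq_trans (ltn_ord i)).
- rewrite IH1 IH2 addrACA -opprD -!big_split.
  by congr (_ - _); apply: eq_bigr => i _; rewrite mulrnDr.
- by rewrite IH1 opprB.
- by rewrite !big1 ?subr0.
Qed.

(** Negative occurrences are moved across the equality, so the test compares natural numbers and can
    be computed. *)
Lemma zeval_eq (V : zmodType) (env : seq V) e1 e2 :
  all (fun i => (zcount true e1 i + zcount false e2 i ==
                 zcount true e2 i + zcount false e1 i)%N)
      (iota 0 (size env)) ->
  zeval env e1 = zeval env e2.
Proof.
move=> /allP eqc; rewrite !zevalE; apply/eqP.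
rewrite subr_eq addrAC eq_sym subr_eq -!big_split /=; apply/eqP.
apply: eq_bigr => i _; rewrite -!mulrnDr.
by have := eqc i; rewrite mem_iota ltn_ord => /(_ isT)/eqP ->.
Qed.

(** Atoms are compared by unification; the inner [match goal] runs [unify] inside a tactic that
    returns a term. *)
Ltac zindex x env :=
  match env with
  | ?y :: _ => let _ := match goal with _ => unify x y end in constr:(0%N)
  | _ :: ?env' => let n := zindex x env' in constr:(S n)
  end.

Ltac zenv e env :=
  match e with
  | (?a + ?b)%R => let env' := zenv a env in zenv b env'
  | (- ?a)%R => zenv a env
  | 0%R => env
  | _ => match env with
         | _ => let n := zindex e env in env
         | _ => constr:(e :: env)
         end
  end.

Ltac zreify e env :=
  match e with
  | (?a + ?b)%R => let x := zreify a env in let y := zreify b env in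
                   constr:(ZAdd x y)
  | (- ?a)%R => let x := zreify a env in constr:(ZOpp x)
  | 0%R => constr:(ZZero)
  | _ => let n := zindex e env in constr:(ZVar n)
  end.

(* Decides equalities that hold in every abelian group. *)
Ltac zmod :=
  match goal with
  | |- @eq ?T ?a ?b =>
      let env0 := zenv a (@nil T) in
      let env := zenv b env0 in
      let x := zreify a env in let y := zreify b env in
      apply: (zeval_eq (env := env) (e1 := x) (e2 := y)); by vm_compute
  end.

(** * The twisted extension *)

Section LieBasics.
Variables (F : fieldType) (L : lieType F) (M : lieModType L).
Implicit Types (x y : L) (m : M).

Lemma lieDl x1 x2 y : lie (x1 + x2) y = lie x1 y + lie x2 y.
Proof. exact: linD (lie_linearl y) _ _. Qed.

Lemma lieDr x y1 y2 : lie x (y1 + y2) = lie x y1 + lie x y2.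
Proof. exact: linD (lie_linearr x) _ _. Qed.

Lemma lieZl a x y : lie (a *: x) y = a *: lie x y.
Proof. exact: linZ (lie_linearl y) _ _. Qed.

Lemma lieZr a x y : lie x (a *: y) = a *: lie x y.
Proof. exact: linZ (lie_linearr x) _ _. Qed.

Lemma lieNl x y : lie (- x) y = - lie x y.
Proof. exact: linN (lie_linearl y) _. Qed.

Lemma lieC x y : lie x y = - lie y x.
Proof.
apply/eqP; rewrite -addr_eq0; apply/eqP.
by have := liexx (x + y); rewrite lieDl !lieDr !liexx add0r addr0.
Qed.

Lemma lie_derivation x y z :
  lie (lie x y) z = lie (lie x z) y + lie x (lie y z).
Proof.
apply/eqP; rewrite -subr_eq0 -(lie_jacobi x y z); apply/eqP.
by rewrite (lieC (lie y z)) (lieC z x) lieNl; zmod.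
Qed.

Lemma actDl x1 x2 m : act (x1 + x2) m = act x1 m + act x2 m.
Proof. exact: linD (act_linearl m) _ _. Qed.

Lemma actDr x m1 m2 : act x (m1 + m2) = act x m1 + act x m2.
Proof. exact: linD (act_linearr x) _ _. Qed.

Lemma actZl a x m : act (a *: x) m = a *: act x m.
Proof. exact: linZ (act_linearl m) _ _. Qed.

Lemma actZr a x m : act x (a *: m) = a *: act x m.
Proof. exact: linZ (act_linearr x) _ _. Qed.

Lemma actNr x m : act x (- m) = - act x m.
Proof. exact: linN (act_linearr x) _. Qed.

Lemma act0r x : act x (0 : M) = 0.
Proof. exact: lin0 (act_linearr x). Qed.

Lemma act_sum x (I : Type) (r : seq I) (P : pred I) (E : I -> M) :
  act x (\sum_(i <- r | P i) E i) = \sum_(i <- r | P i) act x (E i).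
Proof. exact: lin_sum (act_linearr x) _ _ _ _. Qed.

Lemma lbr_rcons (x : L) s y : lbr (x :: rcons s y) = lie (lbr (x :: s)) y.
Proof. by rewrite /= -cats1 foldl_cat. Qed.

Lemma actw_rcons s x m : actw (rcons s x) m = act x (actw s m).
Proof. by rewrite /actw -cats1 foldl_cat. Qed.

End LieBasics.

Section AlternatingForm.
Variables (F : fieldType) (L : lieType F) (M : lieModType L).
Variable phi : L -> L -> M.
Hypothesis Cphi : Ccl2 M phi.

Lemma altDl x1 x2 y : phi (x1 + x2) y = phi x1 y + phi x2 y.
Proof. by case: Cphi => l _ _; exact: linD (l y) _ _. Qed.

Lemma altDr x y1 y2 : phi x (y1 + y2) = phi x y1 + phi x y2.
Proof. by case: Cphi => _ r _; exact: linD (r x) _ _. Qed.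

Lemma altZl a x y : phi (a *: x) y = a *: phi x y.
Proof. by case: Cphi => l _ _; exact: linZ (l y) _ _. Qed.

Lemma altZr a x y : phi x (a *: y) = a *: phi x y.
Proof. by case: Cphi => _ r _; exact: linZ (r x) _ _. Qed.

Lemma alt0l y : phi 0 y = 0.
Proof. by case: Cphi => l _ _; exact: lin0 (l y). Qed.

Lemma altNl x y : phi (- x) y = - phi x y.
Proof. by case: Cphi => l _ _; exact: linN (l y) _. Qed.

Lemma altC x y : phi x y = - phi y x.
Proof.
case: Cphi => _ _ a; apply/eqP; rewrite -addr_eq0; apply/eqP.
by have := a (x + y); rewrite altDl !altDr !a add0r addr0.
Qed.

Lemma Ccl3_dcl2 : Ccl3 M (dcl2 phi).
Proof.
have [_ _ a] := Cphi; split=> [y z c x1 x2|x z c x1 x2|x y c x1 x2|x y].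
- rewrite /dcl2 !lieDl !lieZl !altDl !altDr !altZl !altZr.
  rewrite !actDl !actDr !actZl !actZr.
  by rewrite !scalerDr !scalerN; zmod.
- rewrite /dcl2 !lieDl !lieDr !lieZl !lieZr !altDl !altDr !altZl !altZr.
  rewrite !actDl !actDr !actZl !actZr.
  by rewrite !scalerDr !scalerN; zmod.
- rewrite /dcl2 !lieDr !lieZr !altDl !altDr !altZl !altZr.
  rewrite !actDl !actDr !actZl !actZr.
  by rewrite !scalerDr !scalerN; zmod.
split; rewrite /dcl2 !liexx !a alt0l act0r.
- by zmod.
- by rewrite (lieC y x) altNl (altC y x) actNr; zmod.
- by zmod.
Qed.

End AlternatingForm.

Lemma iter_foldl_nseq (T U : Type) (f : T -> U -> U) n x u :
  iter n (f x) u = foldl (fun v y => f y v) u (nseq n x).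
Proof. by elim: n u => // n IH u; rewrite iterSr IH. Qed.

Section Extension.
Variables (F : fieldType) (L : lieType F) (M : lieModType L).
Variable phi : L -> L -> M.
Hypothesis Cphi : Ccl2 M phi.
Implicit Types (v : M * L).

(* Right multiplication by [(0, x)] for the bracket on [M * L] twisted by [phi],
   which is not a Lie bracket in general, as [phi] need not be a cocycle. *)
Definition extr (x : L) v : M * L :=
  (- act x v.1 + phi v.2 x, lie v.2 x).

Definition extw (v : M * L) (s : seq L) : M * L :=
  foldl (fun v x => extr x v) v s.

Lemma extr_linear x : linear (extr x).
Proof.
move=> a [m1 y1] [m2 y2]; rewrite /extr /=; congr pair; last first.
  by rewrite lieDl lieZl.
rewrite actDr actZr (altDl Cphi) (altZl Cphi) /= scalerDr scalerN; zmod.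
Qed.

Lemma extrD x y v : extr (x + y) v = extr x v + extr y v.
Proof.
case: v => m z; rewrite /extr /=; congr pair; last by rewrite lieDr.
by rewrite actDl (altDr Cphi) /=; zmod.
Qed.

Lemma extrZ a x v : extr (a *: x) v = a *: extr x v.
Proof.
case: v => m z; rewrite /extr /=; congr pair; last by rewrite lieZr.
by rewrite actZl (altZr Cphi) scalerDr scalerN.
Qed.

Lemma iter_extrZ n a x v :
  iter n (extr (a *: x)) v = a ^+ n *: iter n (extr x) v.
Proof.
elim: n => [|n IH]; first by rewrite scale1r.
by rewrite !iterS IH extrZ (linZ (extr_linear x)) scalerA exprS.
Qed.

Lemma extw_rcons v s x : extw v (rcons s x) = extr x (extw v s).
Proof. by rewrite /extw -cats1 foldl_cat. Qed.

Lemma iter_extr n x v : iter n (extr x) v = extw v (nseq n x).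
Proof.
exact: (iter_foldl_nseq extr).
Qed.

(** Appending x applies -x to the M-component, which raises each index k by one, and adds phi of the
    current bracket and x as the new term k = 0. *)
Lemma extwE g s : extw (0, g) s =
  (\sum_(k < size s) (-1) ^+ k *: actw (drop (size s - k) s)
     (phi (lbr (g :: take (size s - k - 1) s)) (nth 0 s (size s - k - 1))),
   lbr (g :: s)).
Proof.
elim/last_ind: s => [|s x IH]; first by rewrite big_ord0.
rewrite extw_rcons IH /extr lbr_rcons /=; congr pair.
rewrite size_rcons big_ord_recl subn0 drop_oversize ?size_rcons // subn1 /=.
rewrite expr0 scale1r -cats1 take_size_cat // nth_cat ltnn subnn /= addrC.
congr (_ + _); rewrite act_sum -sumrN; apply: eq_bigr => i _.
rewrite /bump /= add1n subSS cats1 exprS -scalerA scaleN1r actZr.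
congr (- (_ *: _)).
have ks : (size s - i <= size s)%N by rewrite leq_subr.
rewrite drop_rcons // actw_rcons nth_rcons -cats1 takel_cat; last first.
  by rewrite (leq_trans (leq_subr _ _)).
by rewrite ifT // ltn_subLR ?subn_gt0 // -ltnS subnSK ?ltnS.
Qed.

Variable alpha : L -> L -> L -> M.

(* For [alpha = dcl2 phi], the amount by which the right multiplication by a
   left-normed bracket differs from the commutator of right multiplications. *)
Definition defect_step (f : (L -> M) * L) (y : L) : (L -> M) * L :=
  (fun g => - act y (f.1 g) - f.1 (lie g y) + alpha g f.2 y, lie f.2 y).

Definition defect (x : L) (s : seq L) : L -> M :=
  (foldl defect_step (0, x) s).1.

Lemma defect_rcons x s y g : defect x (rcons s y) g =
  - act y (defect x s g) - defect x s (lie g y) + alpha g (lbr (x :: s)) y.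
Proof.
rewrite /defect -cats1 foldl_cat /=.
suff -> : (foldl defect_step (0, x) s).2 = lbr (x :: s) by [].
rewrite /=; elim: s x (0 : L -> M) => //= z s IH x f; exact: IH.
Qed.

End Extension.

Section ExtensionDefect.
Variables (F : fieldType) (L : lieType F) (M : lieModType L).
Variable phi : L -> L -> M.
Hypothesis Cphi : Ccl2 M phi.

(** Apart from [defect], this is right multiplication by the left-normed bracket (n, b) in E.
    Appending y adds the failure [dcl2 phi] g b y of the Jacobi identity to the defect. *)
Lemma ccomm_extr x s v :
  foldl (fun k y => ccomm (extr phi y) k) (extr phi x) s v =
  (- act (lbr (x :: s)) v.1 + act v.2 (extw phi (0, x) s).1
     + phi v.2 (lbr (x :: s)) + defect (dcl2 phi) x s v.2,
   lie v.2 (lbr (x :: s))).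
Proof.
elim/last_ind: s v => [|s y IH] v.
  by rewrite /= /extr act0r !addr0.
rewrite -[X in foldl _ _ X]cats1 foldl_cat [LHS]/= {1}/ccomm !IH.
rewrite lbr_rcons defect_rcons extw_rcons.
move: (extwE phi x s) => /(congr1 snd) /= e; rewrite -/(lbr (x :: s)) in e.
case: (extw phi (0, x) s) e => n b /= <-; case: v => m g; rewrite /extr /=.
move: (defect _ _ _) => f.
congr pair; last by rewrite [lie (lie g b) y]lie_derivation /=; zmod.
rewrite /dcl2 !actDr !actNr !act_lie.
rewrite (altC Cphi g (lie b y)) (altC Cphi (lie b y)) /=.
zmod.
Qed.

End ExtensionDefect.

(** * Expansion of the defect *)

Section GenSums.
Variable V : zmodType.

Lemma gen_sum n m (G : 'I_m -> seq bool -> V) :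
  gen n (fun w => \sum_(i < m) G i w) = \sum_(i < m) gen n (G i).
Proof. by apply/funext => c; rewrite fct_sumE /gen exchange_big. Qed.

Lemma genMn n m (G : seq bool -> V) :
  gen n (fun w => G w *+ m) = gen n G *+ m.
Proof.
elim: m => [|m IH].
  by rewrite mulr0n; apply/funext => c; rewrite /gen big1.
by rewrite mulrS -IH -genD; apply: gen_ext => w _; rewrite mulrS.
Qed.

End GenSums.

Section DefectExpansion.
Variables (p : nat) (F : fieldType) (L : restrictedLieType p F).
Variable M : restrictedLieModType L.
Variable alpha : L -> L -> L -> M.
Variables h1 h2 : L.

(** The two operators in the recursion for [defect]; P and Q below are their generating versions
    over the letters h1 and h2. *)
Let pi x (f : L -> M) : L -> M := fun g => - act x (f g).
Let kap x (f : L -> M) : L -> M := fun g => - f (lie g x).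

Let piD x : {morph pi x : f g / f + g}.
Proof. by move=> f g; apply/funext => y; rewrite /pi !fctE actDr opprD. Qed.

Let kapD x : {morph kap x : f g / f + g}.
Proof. by move=> f g; apply/funext => y; rewrite /kap !fctE opprD. Qed.

Let foldl_pi f s g : foldl (fun f x => pi x f) f s g =
  (-1) ^+ size s *: actw s (f g).
Proof.
elim/last_ind: s => [|s x IH]; first by rewrite scale1r.
rewrite -[X in foldl _ _ X]cats1 foldl_cat /= {1}/pi IH size_rcons actw_rcons.
by rewrite exprS -scalerA scaleN1r actZr.
Qed.

Let foldl_kap f s g : foldl (fun f x => kap x f) f s g =
  (-1) ^+ size s *: f (lbr (g :: rev s)).
Proof.
elim/last_ind: s g => [|s x IH] g; first by rewrite scale1r.
rewrite -[X in foldl _ _ X]cats1 foldl_cat /= {1}/kap IH size_rcons rev_rcons.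
by rewrite exprS -scalerA scaleN1r.
Qed.

Let word u := [:: h1, h2 & subst_word h1 h2 u].
Let P := gmul (pi h1) (pi h2).
Let Q := gmul (kap h1) (kap h2).
(** The inhomogeneous term that the last letter of [word u] adds to the defect. *)
Let A (u : seq bool) : L -> M := fun g =>
  alpha g (lbr (take (size u).+1 (word u))) (nth 0 (word u) (size u).+1).

Let PD : {morph P : x y / x + y}.
Proof. exact: gmulD. Qed.

Let QD : {morph Q : x y / x + y}.
Proof. exact: gmulD. Qed.

(** Each [pi x] commutes with each [kap y], as one acts on values in M and the other on the argument
    in L. *)
Let PQ z : Q (P z) = P (Q z).
Proof.
have z0 (x : L) : (0 : L -> M) x = 0 by [].
apply/funext => c; apply/funext => g; rewrite /P /Q /gmul /pi /kap.
case: c => [|[|c]]; rewrite !fctE !(add0r, actDr, actNr, opprD, opprK) //=.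
- by rewrite !z0 act0r.
- rewrite !z0 act0r oppr0; zmod.
- by rewrite addrACA.
Qed.

(** Unrolled recursion: the term A created after n - j letters of u meets P + Q once for each of the
    j letters that follow. *)
Let gen_defect n : gen n (fun u => defect alpha h1 (behead (word u))) =
  \sum_(j < n.+1) iter j (fun z => P z + Q z) (gen (n - j) A).
Proof.
elim: n => [|n IH].
  rewrite big_ord1; apply: gen_ext => -[] // _; apply/funext => g.
  by rewrite /defect /A /= act0r !oppr0 !add0r.
rewrite big_ord_recl [in RHS]/= subn0.
rewrite (eq_bigr (fun j : 'I_n.+1 =>
  P (iter j (fun z => P z + Q z) (gen (n - j) A)) +
  Q (iter j (fun z => P z + Q z) (gen (n - j) A)))) //.
rewrite big_split [X in _ + X]/= -(morphD_sum PD) -(morphD_sum QD) -IH.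
rewrite /P /Q !gmul_gen // -!genD; apply: gen_ext => u.
case/lastP: u => // u l; rewrite size_rcons => -[su].
apply/funext => g.
rewrite !fctE last_rcons -[in take _ _]cats1 take_size_cat //.
rewrite /word /= /subst_word map_rcons -rcons_cons defect_rcons addrC.
rewrite /A size_rcons /word /= /subst_word map_rcons.
rewrite nth_rcons size_map ltnn eqxx.
rewrite -cats1 take_size_cat ?size_map //.
by congr (_ + _); case: l.
Qed.

Lemma gen_defect_dstar n : p = n.+2 ->
  gen n (fun u => defect alpha h1 (behead (word u))) =
  gen n (fun u g => dstar_term alpha g (word u)).
(* The operators [P] and [Q] commute, so [(P + Q)^j] expands binomially; this is
   the source of the binomial coefficients in [dstar_term]. *)
Proof.
move=> pE; rewrite gen_defect.
have dstarE u g : dstar_term alpha g (word u) = \sum_(j < n.+1)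
   \sum_(k < j.+1) ((-1) ^+ j *: actw (drop (n - k) (subst_word h1 h2 u))
   (alpha (lbr (g :: rev (drop (n - j) (take (n - k) (subst_word h1 h2 u)))))
               (lbr (take (n - j).+1 (word u)))
               (nth 0 (word u) (n - j).+1))) *+ 'C(j, k).
  (* The type of [L] depends on p, so p is replaced by n + 2 only in the occurrences abstracted here
     as q. *)
  pose D q := \sum_(j < q.-1) (-1) ^+ j *: \sum_(k < j.+1) 'C(j, k)%:R *:
    actw (drop (q - k) (word u))
      (alpha (lbr (g :: rev (drop (q - j) (take (q - k) (word u)))))
             (lbr (take (q - j - 1) (word u)))
             (nth 0 (word u) (q - j - 1))).
  transitivity (D n.+2); first exact: (congr1 D pE).
  apply: eq_bigr => j _; rewrite scaler_sumr.
  apply: eq_bigr => k _.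
  have jn : (j <= n)%N by rewrite -ltnS.
  have kn : (k <= n)%N by rewrite (leq_trans _ jn) // -ltnS.
  rewrite scalerA mulrC -scalerA scaler_nat.
  have e i : (i <= n)%N -> (n.+2 - i = (n - i).+2)%N.
    by move=> le_in; rewrite !subSn // leqW.
  by rewrite !e // subn1.
transitivity (gen n (fun u : seq bool => \sum_(j < n.+1) \sum_(k < j.+1)
   (fun g => (-1) ^+ j *: actw (drop (n - k) (subst_word h1 h2 u))
   (alpha (lbr (g :: rev (drop (n - j) (take (n - k) (subst_word h1 h2 u)))))
               (lbr (take (n - j).+1 (word u)))
               (nth 0 (word u) (n - j).+1))) *+ 'C(j, k))); last first.
  apply: gen_ext => u _; apply/funext => g; rewrite dstarE fct_sumE.
  apply: eq_bigr => j _; rewrite fct_sumE; apply: eq_bigr => k _.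
  by elim: 'C(_, _) => // m IH; rewrite !mulrS fctE IH.
rewrite gen_sum; apply: eq_bigr => j _.
(* After the prefix of length n - j, the next j - k letters act by Q and the last k by P; the signs
   multiply to (-1)^j. *)
rewrite (iterD_commute _ _ PD QD PQ) gen_sum; apply: eq_bigr => k _.
have jn : (j <= n)%N by rewrite -ltnS.
have kj : (k <= j)%N by rewrite -ltnS.
have kn := leq_trans kj jn.
rewrite genMn; congr (_ *+ _); rewrite /Q iter_gmul_gen //.
have -> : (n - j + (j - k) = n - k)%N by rewrite addnBA // subnK.
rewrite /P iter_gmul_gen // subnK //; apply: gen_ext => u su.
apply/funext => g.
have foldE (o : L -> (L -> M) -> (L -> M)) f v :
    foldl (fun f (l : bool) => (if l then o h1 else o h2) f) f v =
    foldl (fun f x => o x f) f (subst_word h1 h2 v).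
  by rewrite /subst_word; elim: v f => //= l v IH f; rewrite IH; case: l.
rewrite !foldE foldl_pi foldl_kap.
have sZ q x y : actw q (x *: y : M) = x *: actw q y.
  by elim: q y => //= z q IH y; rewrite actZr IH.
rewrite sZ scalerA -exprD !size_map !size_drop size_takel ?su ?leq_subr //.
have -> : (n - (n - k) + (n - k - (n - j)) = j)%N.
  by rewrite addnBA ?leq_sub2l // subnK ?leq_subr // subKn.
rewrite take_takel ?leq_sub2l // /A size_takel ?su ?leq_subr //.
rewrite /word /subst_word !map_drop !map_take.
move: (map _ u) => w; move: (n - j)%N => m.
congr (_ *: actw _ (alpha _ _ _)); last first.
  by case: m => //= m; rewrite nth_take.
by case: m => //= m; rewrite take_takel.
Qed.
End DefectExpansion.

(** * Restricted cochains *)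

Lemma fst_sum (U V : zmodType) (I : Type) (r : seq I) (P : pred I)
    (E : I -> U * V) :
  (\sum_(i <- r | P i) E i).1 = \sum_(i <- r | P i) (E i).1.
Proof. exact: (big_morph fst). Qed.

(** [G1] and [G2] may differ word by word; agreement for each number of letters [true] suffices. *)
Lemma sum_weighted_gen (F : fieldType) (V : lmodType F) n (wt : nat -> F)
    (G1 G2 : seq bool -> V) : gen n G1 = gen n G2 ->
  \sum_(w : n.-tuple bool) wt (occ w) *: G1 w =
  \sum_(w : n.-tuple bool) wt (occ w) *: G2 w.
Proof.
move=> eG; rewrite -!sum_gen; apply: eq_bigr => c _.
by move/(congr1 (@^~ (c : nat))): eG; rewrite /gen => ->.
Qed.

Lemma behead_subst_word (T : Type) (x y : T) w :
  behead (subst_word x y w) = subst_word x y (behead w).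
Proof. by case: w. Qed.

Lemma subst_word_admissible (T : Type) (x y : T) w : admissible w ->
  subst_word x y w = x :: behead (subst_word x y w).
Proof. by case: w => // -[]. Qed.

Lemma jacobson_word (F : fieldType) (p : nat) (V : lmodType F) (I : Type)
    (r : I -> V -> V) (x y : I) v :
  p \in [pchar F] -> (forall i, {morph r i : u v / u + v}) ->
  iter p (fun u => r x u + r y u) v = iter p (r x) v + iter p (r y) v +
  \sum_(w : p.-tuple bool | admissible w) (occ w)%:R^-1 *:
    foldl (fun k z => ccomm (r z) k) (r x) (behead (subst_word x y w)) v.
Proof.
move=> charFp rD; rewrite (jacobson charFp (rD x) (rD y)); congr (_ + _).
apply: eq_bigr => w _; rewrite behead_subst_word; congr (_ *: _).
suff eqf k u :
    foldl (fun k (l : bool) => ccomm (if l then r x else r y) k) k u =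
    foldl (fun k z => ccomm (r z) k) k (subst_word x y u) by rewrite eqf.
by rewrite /subst_word; elim: u k => //= l u IH k; rewrite IH; case: l.
Qed.

Section Cochains.
Variables (p : nat) (F : fieldType) (L : restrictedLieType p F).
Variable M : restrictedLieModType L.
Hypothesis charFp : p \in [pchar F].

Let p_gt1 : (1 < p)%N := prime_gt1 (pcharf_prime charFp).

Lemma star_termE (phi : L -> L -> M) x s : size s = p.-1 ->
  star_term phi (x :: s) = (extw phi (0, x) s).1.
Proof.
move=> ss; rewrite extwE /star_term /= ss; apply: eq_bigr => k _.
have e : (p - k = (p.-1 - k).+1)%N.
  by rewrite -subSn ?prednK // ltnW.
have kp : (0 < p.-1 - k)%N by rewrite subn_gt0.
by rewrite e /= subSS subn0 -(prednK kp) /= subn1.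
Qed.

(** The alternating sum is the M-component of (0, g) after p right multiplications by h in E. *)
Lemma delta2E (c : (L -> L -> M) * (L -> M)) g h : (delta2 c).2 g h =
  c.1 g (Defs.pmap h) - (iter p (extr c.1 h) (0, g)).1 + act g (c.2 h).
Proof.
rewrite /delta2 /= iter_extr extwE size_nseq /=; congr (_ - _ + _).
apply: eq_bigr => i _; have ip : (0 < p - i)%N by rewrite subn_gt0.
rewrite drop_nseq take_nseq ?nth_nseq; last by rewrite -subnDA leq_subr.
rewrite ifT; last by rewrite subn1 prednK // leq_subr.
rewrite subKn ?(ltnW (ltn_ord i)) // -subn1 subnAC; congr (_ *: _).
rewrite /actw; elim: (val i) (c.1 _ _) => //= n IH m.
by rewrite -IH -iterS iterSr.
Qed.

(** * The image of [delta1] *)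

Section Coboundary.
Variable psi : L -> M.
Hypothesis Cpsi : C1 M psi.

Lemma C2_dcl1 : Ccl2 M (dcl1 psi).
Proof.
have lpsi : linear psi by [].
split=> [y a x1 x2|x a y1 y2|x]; rewrite /dcl1.
- rewrite lieDl lieZl !(linD lpsi) !(linZ lpsi) actDl actZl actDr actZr.
  by rewrite !scalerDr scalerN; zmod.
- rewrite lieDr lieZr !(linD lpsi) !(linZ lpsi) actDl actZl actDr actZr.
  by rewrite !scalerDr scalerN; zmod.
- by rewrite liexx (lin0 lpsi); zmod.
Qed.

(* Right bracket with [(- psi x, x)] in the semidirect product of [L] by [M],
   represented on [M * F]. *)
Definition sdr (x : L) (v : M * F^o) : M * F^o :=
  (- act x v.1 + (v.2 : F) *: psi x, 0).

Lemma sdrD x : {morph sdr x : u v / u + v}.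
Proof.
move=> [m1 c1] [m2 c2]; rewrite /sdr /=; congr pair; last by rewrite addr0.
by rewrite /= actDr scalerDl; zmod.
Qed.

Lemma iter_sdr n x m :
  iter n (sdr x) (m, 0) = ((-1) ^+ n *: iter n (act x) m, 0).
Proof.
elim: n => [|n IH]; first by rewrite scale1r.
by rewrite iterS IH /sdr /= scale0r addr0 actZr exprS -scalerA scaleN1r.
Qed.

Lemma iter_sdr_pchar x :
  iter p (sdr x) (0, 1) = (iter p.-1 (act x) (psi x), 0).
Proof.
rewrite -[X in iter X](prednK (ltnW p_gt1)) iterSr.
rewrite {2}/sdr /= act0r oppr0 add0r scale1r iter_sdr.
by rewrite (sign_pred_pchar charFp) scale1r.
Qed.

(** The map (n, b) |-> (n - psi b, b) carries E, twisted by [dcl1 psi], onto the semidirect product;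
    the commutator is the right bracket with the image of the left-normed bracket of E. *)
Lemma ccomm_sdr x s v : foldl (fun k y => ccomm (sdr y) k) (sdr x) s v =
  (- act (lbr (x :: s)) v.1 -
     (v.2 : F) *: ((extw (dcl1 psi) (0, x) s).1 - psi (lbr (x :: s))), 0).
Proof.
have lpsi : linear psi by [].
elim/last_ind: s v => [|s y IH] v.
  by rewrite /sdr /= sub0r scalerN opprK.
rewrite -[X in foldl _ _ X]cats1 foldl_cat [LHS]/= {1}/ccomm !IH.
rewrite lbr_rcons extw_rcons.
move: (extwE (dcl1 psi) x s) => /(congr1 snd) /= e.
rewrite -/(lbr (x :: s)) in e.
case: (extw _ (0, x) s) e => n b /= <-; case: v => m c; rewrite /sdr /extr /=.
congr pair; last by rewrite subr0.
rewrite !(actDr, actNr, actZr) act_lie /dcl1 /= !(scalerDr, scalerN, scale0r).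
by zmod.
Qed.

Lemma C2_delta1 : C2 M (delta1 psi).
Proof.
have lpsi : linear psi by [].
split; first exact: C2_dcl1.
split=> [a g|g h] /=.
  rewrite pmapZ (linZ lpsi) scalerBr; congr (_ - _).
  rewrite (linZ lpsi) -[X in _ ^+ X](prednK (ltnW p_gt1)).
  elim: p.-1 => [|n IH]; first by rewrite expr1.
  by rewrite !iterS IH actZl actZr scalerA -exprS.
(* Since [sdr] is additive in x, Jacobson's formula now expands this p-th power at g + h. *)
have Ng x : iter p.-1 (act x) (psi x) = (iter p (sdr x) (0, 1)).1.
  by rewrite iter_sdr_pchar.
have sdr_add : sdr (g + h) = fun v => sdr g v + sdr h v.
  apply/funext => v; rewrite /sdr; congr pair; last by rewrite /= addr0.
  by rewrite /= actDl (linD lpsi) scalerDr; zmod.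
rewrite !Ng sdr_add (jacobson_word _ _ _ charFp sdrD) /= fst_sum pmapD.
rewrite !(linD lpsi) (lin_sum lpsi).
set S1 := \sum_(_ | _) psi _; set S2 := \sum_(_ | _) (_).1.
set S3 := \sum_(_ | _) _.
suff -> : S3 = S1 - S2 by zmod.
rewrite /S1 /S2 -sumrB; apply: eq_bigr => w aw.
rewrite (linZ lpsi) -scalerBr [subst_word g h w]subst_word_admissible //.
rewrite star_termE; last first.
  by rewrite behead_subst_word !size_map size_behead size_tuple.
congr (_ *: _); rewrite ccomm_sdr /= act0r scale1r; zmod.
Qed.

Lemma delta2_delta1 : delta2 (delta1 psi) = 0.
Proof.
have lpsi : linear psi by [].
congr pair.
  apply/funext => g; apply/funext => h; apply/funext => f.
  have z0 : (0 : L -> L -> L -> M) g h f = 0 by [].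
  rewrite z0 /dcl2 /= /dcl1 !(actDr, actNr, act_lie).
  rewrite (lie_derivation g h f) (lieC (lie h f) g) !(linD lpsi) !(linN lpsi).
  zmod.
  apply/funext => g; apply/funext => h.
  transitivity ((delta2 (delta1 psi)).2 g h) => //.
  rewrite delta2E /=.
  (* The p-fold commutator at (0, 1) is computed twice, by ad(T)^p = ad(T^p) and by [ccomm_sdr];
     this determines the alternating sum in [delta2]. *)
  have := iter_ccomm_pchar (sdr g) (@sdrD h) charFp (0, 1).
  have -> : iter p (ccomm (sdr h)) (sdr g) =
      foldl (fun k y => ccomm (sdr y) k) (sdr g) (nseq p h).
    exact: (iter_foldl_nseq (fun y k => ccomm (sdr y) k)).
  rewrite ccomm_sdr iter_sdr_pchar.
  rewrite {1}/sdr /= !act0r !oppr0 !scale1r !add0r iter_sdr => /(congr1 fst) /=.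
  rewrite -iter_extr; move: (iter p (extr _ _) _).1 => t.
  move=> e; have z0 : (0 : L -> L -> M) g h = 0 by [].
  rewrite z0 /dcl1 act_pmap lie_pmap actDr actNr.
  suff -> : t = psi (lbr (g :: nseq p h)) + iter p (act h) (psi g)
              - act g (iter p.-1 (act h) (psi h)) by zmod.
  move/(congr1 -%R): e; rewrite opprK => /(canRL (subrK _)) -> /=.
  rewrite act0r (sign_pchar charFp) scale0r scale1r scaleN1r.
  by rewrite oppr0 add0r addr0; zmod.
Qed.
End Coboundary.
End Cochains.

(** * The image of [delta2] *)

Section RestrictedCocycles.
Variables (p : nat) (F : fieldType) (L : restrictedLieType p F).
Variable M : restrictedLieModType L.
Hypothesis charFp : p \in [pchar F].

Lemma C3_delta2 (c : (L -> L -> M) * (L -> M)) : C2 M c -> C3 M (delta2 c).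
Proof.
have p_gt1 := prime_gt1 (pcharf_prime charFp).
case: c => phi omega [/= Cphi [omegaZ omegaD]].
split; first exact: Ccl3_dcl2.
have extrL x : linear (extr phi x) by exact: extr_linear.
split=> [h a g1 g2|a g h|g h1 h2]; rewrite !delta2E /=.
- have -> : (0 : M, a *: g1 + g2) = a *: (0, g1) + (0, g2).
    by congr pair; rewrite /= scaler0 addr0.
  rewrite (linear_iter _ (extrL h)) (altDl Cphi) (altZl Cphi) actDl actZl /=.
  by rewrite !scalerDr scalerN; zmod.
- rewrite pmapZ (altZr Cphi) omegaZ actZr scalerDr scalerBr; congr (_ - _ + _).
  by rewrite (iter_extrZ Cphi).
have ext_add : extr phi (h1 + h2) = fun v => extr phi h1 v + extr phi h2 v.
  by apply/funext => v; rewrite (extrD Cphi).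
rewrite ext_add (jacobson_word _ _ _ charFp (fun x => linD (extrL x))).
rewrite /= fst_sum.
rewrite pmapD omegaD !actDr !(altDr Cphi) act_sum.
rewrite (lin_sum (f := phi g)); last by case: Cphi.
set S1 := \sum_(_ | _) phi g _; set S2 := \sum_(_ | _) (_).1.
set S3 := \sum_(_ | _) act g _; set S4 := \sum_(_ | _) _.
suff -> : S4 = S2 - S1 - S3 by zmod.
(* Word by word, this is [ccomm_extr] at (0, g). *)
have {S1 S2 S3} -> : S2 - S1 - S3 = \sum_(w : p.-tuple bool | admissible w)
    (occ w)%:R^-1 *: defect (dcl2 phi) h1 (behead (subst_word h1 h2 w)) g.
  rewrite -!sumrB; apply: eq_bigr => w aw.
  rewrite (altZr Cphi) actZr -!scalerBr; congr (_ *: _).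
  have -> : star_term phi (subst_word h1 h2 w) =
      (extw phi (0, h1) (behead (subst_word h1 h2 w))).1.
    rewrite [subst_word h1 h2 w]subst_word_admissible // star_termE //.
    by rewrite behead_subst_word !size_map size_behead size_tuple.
  rewrite (ccomm_extr Cphi) -subst_word_admissible //= act0r; zmod.
have [n pE] : exists n, p = n.+2 by exists p.-2; case: (p) p_gt1 => [|[|]].
pose D w := (occ w)%:R^-1 *: dstar_term (dcl2 phi) g (subst_word h1 h2 w).
pose E w := (occ w)%:R^-1 *:
  defect (dcl2 phi) h1 (behead (subst_word h1 h2 w)) g.
have sumE (G : seq bool -> M) :
    \sum_(w : p.-tuple bool | admissible w) G w =
    \sum_(w : n.-tuple bool) G [:: true, false & w].
  pose S q := \sum_(w : q.-tuple bool | admissible w) G w.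
  by rewrite -sum_admissible; exact: (congr1 S pE).
rewrite /S4 (sumE D) (sumE E) /D /E /occ /=.
symmetry.
have /(congr1 (fun z c => z c g)) := gen_defect_dstar (dcl2 phi) h1 h2 pE.
have genE (G : seq bool -> L -> M) :
    (fun c => gen n G c g) = gen n (fun w => G w g).
  by apply/funext => c; rewrite /gen fct_sumE.
(* The two forced letters turn the weight into 1/(1 + m) with m = [occ w], still a function of
   [occ w]. *)
by rewrite !genE => /(sum_weighted_gen (fun m => (1 + (0 + m))%:R^-1)).
Qed.

(** * Linearity of the cochain spaces and differentials *)

Lemma star_term_linear s : linear (fun phi : L -> L -> M => star_term phi s).
Proof.
move=> a phi1 phi2; rewrite /star_term scaler_sumr -big_split.
apply: eq_bigr => k _ /=; rewrite scalerA mulrC -scalerA -scalerDr.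
congr (_ *: _); rewrite !fctE.
elim: (drop _ _) (phi1 _ _) (phi2 _ _) => //= x q IH m1 m2.
by rewrite actDr actZr IH.
Qed.

Lemma dstar_term_linear g s :
  linear (fun alpha : L -> L -> L -> M => dstar_term alpha g s).
Proof.
move=> a alpha1 alpha2; rewrite /dstar_term scaler_sumr -big_split.
apply: eq_bigr => j _ /=; rewrite scalerA mulrC -scalerA -scalerDr.
congr (_ *: _); rewrite scaler_sumr -big_split; apply: eq_bigr => k _ /=.
rewrite scalerA mulrC -scalerA -scalerDr; congr (_ *: _); rewrite !fctE.
elim: (drop _ _) (alpha1 _ _ _) (alpha2 _ _ _) => //= x q IH m1 m2.
by rewrite actDr actZr IH.
Qed.

Lemma subspace_C1 : subspace (C1 M).
Proof.
split=> [a x y|a f g lf lg b x y].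
  by have z0 (z : L) : (0 : L -> M) z = 0 by []; rewrite !z0 scaler0 addr0.
rewrite !fctE (lf : linear _) (lg : linear _) !scalerDr !scalerA [a * b]mulrC.
by zmod.
Qed.

Lemma subspace_C2 : subspace (C2 M).
Proof.
have z1 (z : L) : (0 : L -> M) z = 0 by [].
have z2 (x y : L) : (0 : L -> L -> M) x y = 0 by [].
split.
  split; first by split=> [y a x1 x2|x a y1 y2|x];
    rewrite /= !z2 ?scaler0 ?addr0.
  split=> [a g|g h]; rewrite /= !z1 ?scaler0 // big1 ?addr0 // => w _.
  by rewrite (lin0 (star_term_linear _)) scaler0.
move=> a [f1 w1] [f2 w2] [/= [l1 r1 a1] [Z1 D1]] [/= [l2 r2 a2] [Z2 D2]].
split; first split=> [y b x1 x2|x b y1 y2|x] /=; rewrite ?fctE.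
- rewrite l1 l2 !scalerDr !scalerA [a * b]mulrC; zmod.
- rewrite r1 r2 !scalerDr !scalerA [a * b]mulrC; zmod.
- by rewrite a1 a2 scaler0 addr0.
split=> [b g|g h] /=; rewrite ?fctE.
  by rewrite Z1 Z2 scalerDr !scalerA mulrC.
rewrite D1 D2 !scalerDr.
under [in RHS]eq_bigr => w _ do
  rewrite star_term_linear scalerDr scalerA mulrC -scalerA.
by rewrite big_split -scaler_sumr /=; zmod.
Qed.

Lemma subspace_C3 : subspace (C3 M).
Proof.
have z2 (x y : L) : (0 : L -> L -> M) x y = 0 by [].
have z3 (x y z : L) : (0 : L -> L -> L -> M) x y z = 0 by [].
split.
  split; first by split=> [y z a x1 x2|x z a y1 y2|x y a u v|x y];
     rewrite /= ?z3 ?scaler0 ?addr0.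
  split=> [h a g1 g2|a g h|g h1 h2]; rewrite /= !z2 ?scaler0 ?addr0 //.
  rewrite big1 ?subr0 // => w _.
  by rewrite (lin0 (dstar_term_linear _ _)) scaler0.
move=> a [f1 w1] [f2 w2].
move=> [/= [l1 m1 r1 a1] [K1 Z1 D1]] [/= [l2 m2 r2 a2] [K2 Z2 D2]].
split; first split=> [y z b x1 x2|x z b y1 y2|x y b w z|x y] /=; rewrite ?fctE.
- rewrite l1 l2 !scalerDr !scalerA [a * b]mulrC; zmod.
- rewrite m1 m2 !scalerDr !scalerA [a * b]mulrC; zmod.
- rewrite r1 r2 !scalerDr !scalerA [a * b]mulrC; zmod.
- have [-> -> ->] := a1 x y; have [-> -> ->] := a2 x y.
  by rewrite scaler0 addr0.
split=> [h b x y|b x h|g h1 h2] /=; rewrite ?fctE.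
- rewrite K1 K2 !scalerDr !scalerA [a * b]mulrC; zmod.
- by rewrite Z1 Z2 scalerDr !scalerA mulrC.
rewrite D1 D2 !scalerDr scalerN.
under [in RHS]eq_bigr => w _ do
  rewrite dstar_term_linear scalerDr scalerA mulrC -scalerA.
by rewrite big_split -scaler_sumr /=; zmod.
Qed.

Lemma delta1_linear : linear_on (C1 M) (@delta1 p F L M).
Proof.
move=> a f g lf lg; congr pair.
  apply/funext => x; apply/funext => y.
  rewrite -[RHS]/(a *: dcl1 f x y + dcl1 g x y) /dcl1 !fctE.
  by rewrite !(actDr, actZr, scalerDr, scalerN); zmod.
apply/funext => x; rewrite -[RHS]/(a *: (delta1 f).2 x + (delta1 g).2 x) /=.
rewrite !fctE scalerBr.
by rewrite (linear_iter _ (act_linearr x)); zmod.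
Qed.

Lemma delta2_linear : linear_on (C2 M) (@delta2 p F L M).
Proof.
move=> a [f1 w1] [f2 w2] _ _; congr pair.
  apply/funext => x; apply/funext => y; apply/funext => z.
  rewrite -[RHS]/(a *: dcl2 f1 x y z + dcl2 f2 x y z) /dcl2 /= !fctE.
  by rewrite !(actDr, actZr, scalerDr, scalerN); zmod.
apply/funext => g; apply/funext => h.
rewrite -[RHS]/(a *: (delta2 (f1, w1)).2 g h + (delta2 (f2, w2)).2 g h) /=.
rewrite !fctE.
under eq_bigr => i _ do
  rewrite (linear_iter _ (act_linearr h)) scalerDr scalerA mulrC -scalerA.
rewrite big_split -scaler_sumr /= !(actDr, actZr, scalerDr, scalerN); zmod.
Qed.

End RestrictedCocycles.

(** * Quotients *)

Section Quotient.
Variables (F : fieldType) (V : lmodType F) (Z B : set V).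
Hypotheses (sZ : subspace Z) (sB : subspace B) (BZ : B `<=` Z).

Let Z0 : Z 0. Proof. by case: sZ. Qed.
Let ZL a x y : Z x -> Z y -> Z (a *: x + y).
Proof. by case: sZ => _; apply. Qed.
Let ZD x y : Z x -> Z y -> Z (x + y).
Proof. by move=> Zx Zy; rewrite -[x]scale1r; apply: ZL. Qed.
Let ZS a x : Z x -> Z (a *: x).
Proof. by move=> Zx; rewrite -[_ *: _]addr0; apply: ZL. Qed.
Let B0 : B 0.
Proof. by case: sB. Qed.
Let BL a x y : B x -> B y -> B (a *: x + y).
Proof. by case: sB => _; apply. Qed.
Let BN x : B x -> B (- x).
Proof. by move=> Bx; rewrite -scaleN1r -[_ *: _]addr0; apply: BL. Qed.
Let BD x y : B x -> B y -> B (x + y).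
Proof. by move=> Bx By; rewrite -[x]scale1r; apply: BL. Qed.
Let BS a x : B x -> B (a *: x).
Proof. by move=> Bx; rewrite -[_ *: _]addr0; apply: BL. Qed.

(* A representative of the class [x + B] that depends only on that class. *)
Definition coset_repr (x : V) : V := xget 0 [set y | B (x - y)].

Let reprP x : B (x - coset_repr x).
Proof.
by apply: (@xgetPex _ 0 [set y | B (x - y)]); exists x; rewrite /= subrr.
Qed.

(** Both choices are made from the same set, by extensionality. *)
Let repr_eq x y : B (x - y) -> coset_repr x = coset_repr y.
Proof.
move=> Bxy; rewrite /coset_repr; congr xget; apply/funext => z /=.
apply/propext; split=> Bz.
  have -> : y - z = - (x - y) + (x - z) by zmod.
  exact/BD/Bz/BN.
have -> : x - z = (x - y) + (y - z) by zmod.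
exact: BD.
Qed.

Let repr_idem x : coset_repr (coset_repr x) = coset_repr x.
Proof. by apply: repr_eq; rewrite -opprB; exact/BN/reprP. Qed.

Let repr_Z x : Z x -> Z (coset_repr x).
Proof.
move=> Zx; have -> : coset_repr x = (-1) *: (x - coset_repr x) + x.
  by rewrite scaleN1r; zmod.
exact/ZL/Zx/BZ/reprP.
Qed.

(** Cosets are encoded by their chosen representatives, so equality of classes is equality in V. *)
Definition quot := {x : V | `[< Z x /\ coset_repr x = x >]}.

HB.instance Definition _ := [Choice of quot by <:].

Let quot_Z (q : quot) : Z (val q).
Proof. by case: q => x /= /asboolP[]. Qed.

Let quot_repr (q : quot) : coset_repr (val q) = val q.
Proof. by case: q => x /= /asboolP[]. Qed.

Let qcls_subproof x : `[< Z (coset_repr (if `[< Z x >] then x else 0)) /\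
  coset_repr (coset_repr (if `[< Z x >] then x else 0)) =
  coset_repr (if `[< Z x >] then x else 0) >].
Proof.
apply/asboolP; split; last exact: repr_idem.
by apply: repr_Z; case: asboolP.
Qed.

(** Outside Z the value is the class of 0, which makes the map total. *)
Definition qcls (x : V) : quot :=
  @exist V (fun y => `[< Z y /\ coset_repr y = y >]) _ (qcls_subproof x).

Let qclsE x : Z x -> val (qcls x) = coset_repr x.
Proof. by move=> Zx; rewrite /qcls /=; case: asboolP. Qed.

Let qcls_val q : qcls (val q) = q.
Proof. by apply: val_inj; rewrite qclsE ?quot_repr. Qed.

Let qcls_eq x y : Z x -> Z y -> B (x - y) -> qcls x = qcls y.
Proof.
by move=> Zx Zy Bxy; apply: val_inj; rewrite !qclsE //; exact: repr_eq.
Qed.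

Let val_qcls x : Z x -> B (val (qcls x) - x).
Proof. by move=> Zx; rewrite qclsE // -opprB; exact/BN/reprP. Qed.

Definition qadd (q r : quot) := qcls (val q + val r).
Definition qopp (q : quot) := qcls (- val q).
Definition qscale (a : F) (q : quot) := qcls (a *: val q).

Let ZN x : Z x -> Z (- x).
Proof. by move=> Zx; rewrite -scaleN1r; exact: ZS. Qed.

Let qaddE x y : Z x -> Z y -> qadd (qcls x) (qcls y) = qcls (x + y).
Proof.
move=> Zx Zy; apply: qcls_eq; [exact/ZD/quot_Z/quot_Z|exact: ZD|].
by have := BD (val_qcls Zx) (val_qcls Zy); rewrite addrACA -opprD.
Qed.

Let qscaleE a x : Z x -> qscale a (qcls x) = qcls (a *: x).
Proof.
move=> Zx; apply: qcls_eq; [exact/ZS/quot_Z|exact: ZS|].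
by rewrite -scalerBr; exact/BS/val_qcls.
Qed.

Ltac solve_Z :=
  by repeat first [exact: Z0 | exact: quot_Z | assumption
                  | apply: ZD | apply: ZS | apply: ZN].

Let qaddA : associative qadd.
Proof.
move=> q r s; rewrite -[q]qcls_val -[r]qcls_val -[s]qcls_val.
by rewrite !qaddE ?addrA //; solve_Z.
Qed.

Let qaddC : commutative qadd.
Proof. by move=> q r; rewrite /qadd addrC. Qed.

Let qadd0 : left_id (qcls 0) qadd.
Proof.
by move=> q; rewrite -[q]qcls_val qaddE ?add0r //; solve_Z.
Qed.

Let qaddN : left_inverse (qcls 0) qopp qadd.
Proof.
move=> q; rewrite -{2}[q]qcls_val /qopp qaddE ?addNr //; solve_Z.
Qed.

HB.instance Definition _ := GRing.isZmodule.Build quot qaddA qaddC qadd0 qaddN.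

Let qscaleA a b q : qscale a (qscale b q) = qscale (a * b) q.
Proof. by rewrite -[q]qcls_val !qscaleE ?scalerA //; solve_Z. Qed.

Let qscale1 : left_id 1 qscale.
Proof. by move=> q; rewrite -[q]qcls_val qscaleE ?scale1r //; solve_Z. Qed.

Let qscaleDr : right_distributive qscale +%R.
Proof.
move=> a q r; rewrite -[q]qcls_val -[r]qcls_val.
by rewrite [_ + _]qaddE ?qscaleE ?[RHS]qaddE ?scalerDr //; solve_Z.
Qed.

Let qscaleDl q : {morph qscale^~ q : a b / a + b}.
Proof.
move=> a b; rewrite -[q]qcls_val.
by rewrite !qscaleE ?[RHS]qaddE ?scalerDl //; solve_Z.
Qed.

HB.instance Definition _ := GRing.Zmodule_isLmodule.Build F quot
  qscaleA qscale1 qscaleDr qscaleDl.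

Lemma qcls_quotient : is_quotient Z B qcls.
Proof.
split=> [a x y Zx Zy|q|].
- by rewrite [a *: qcls x]qscaleE ?[RHS]qaddE //; solve_Z.
- by exists (val q); [exact: quot_Z|exact: qcls_val].
apply/seteqP; split=> x /=.
  move=> Bx; split; first exact: BZ.
  by apply: qcls_eq; [exact: BZ|exact: Z0|rewrite subr0].
move=> [Zx /(congr1 val)]; rewrite !qclsE // => e.
(* x and 0 share their representative, so x is a difference of two elements of B. *)
have -> : x = (x - coset_repr x) - (0 - coset_repr 0) by rewrite e; zmod.
by apply: BD; [|apply: BN]; exact: reprP.
Qed.

End Quotient.

Lemma quotient_exists (F : fieldType) (V : lmodType F) (Z B : set V) :
  subspace Z -> subspace B -> B `<=` Z ->
  exists (Q : lmodType F) (pi : V -> Q), is_quotient Z B pi.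
Proof.
by move=> sZ sB BZ; exists (quot Z B), (qcls sZ sB BZ); exact: qcls_quotient.
Qed.

Theorem theorem3p13 (F : fieldType) (p : nat) (charFp : p \in [pchar F])
    (L : restrictedLieType p F) (M : restrictedLieModType L) :
  [/\ [/\ subspace (C1 M), subspace (C2 M) & subspace (C3 M)],
      (forall psi, C1 M psi -> C2 M (delta1 psi)) /\
        linear_on (C1 M) (@delta1 p F L M),
      (forall c, C2 M c -> C3 M (delta2 c)) /\
        linear_on (C2 M) (@delta2 p F L M),
      forall psi, C1 M psi -> delta2 (delta1 psi) = 0
    & [/\ subspace (ker2 M), subspace (im1 M), im1 M `<=` ker2 M
        & exists (H2 : lmodType F) (pi : (L -> L -> M) * (L -> M) -> H2),
            is_quotient (ker2 M) (im1 M) pi]].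
Proof.
have [C1_0 C1_L] := subspace_C1 M; have [C2_0 C2_L] := subspace_C2 M.
(* Linearity with a = -1 at the pair 0, 0 gives -f(0) + f(0) = 0. *)
have d1_0 : delta1 (0 : L -> M) = 0.
  have /= := delta1_linear (-1) C1_0 C1_0.
  by rewrite !scaleN1r oppr0 addr0 addNr.
have d2_0 : delta2 (0 : (L -> L -> M) * (L -> M)) = 0.
  have /= := delta2_linear (-1) C2_0 C2_0.
  by rewrite !scaleN1r oppr0 addr0 addNr.
have sub_ker : subspace (ker2 M).
  split; first by split.
  move=> a x y [Cx dx] [Cy dy]; split; first exact: C2_L.
  by rewrite delta2_linear // dx dy scaler0 addr0.
have sub_im : subspace (im1 M).
  split; first by exists 0.
  move=> a _ _ [f Cf <-] [g Cg <-]; exists (a *: f + g); first exact: C1_L.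
  by rewrite delta1_linear.
have im_ker : im1 M `<=` ker2 M.
  by move=> _ [f Cf <-]; split; [exact: C2_delta1|exact: delta2_delta1].
split.
- split; [exact: subspace_C1|exact: subspace_C2|exact: subspace_C3].
- by split=> [psi|]; [exact: C2_delta1|exact: delta1_linear].
- by split=> [c|]; [exact: C3_delta2|exact: delta2_linear].
- by move=> psi; exact: delta2_delta1.
- by split=> //; exact: quotient_exists.
Qed.
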